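(* Let $T$ be the infinite ternary tree with origin $o$ and principal branches labeled $Y^{(1)}, Y^{(2)}, Y^{(3)}$ in correspondence with the direction indexing of the rotor at the origin. Set the rotors along the rightmost path to infinity in $Y^{(3)}$ initially pointing in direction $2$, and all remaining rotors initially pointing in direction $1$. Let $E(m)$ be the expected number of chips that return to the origin if $m$ chips, started at the origin, perform independent simple random walks on $T$. Let $R(m)$ be the number of chips that return to the origin if $m$ chips started at the origin sequentially perform rotor-router walks on $T$. Then $|E(m) - R(m)| \leq \frac{1}{2}$ for all $m$.
   Context: The infinite ternary tree is the infinite $3$-regular tree. The principal branches are the three subtrees rooted at the neighbors of $o$. The parent of a vertex $v\neq o$ is its neighbor closer to $o$; the other two neighbors are its children. Rotor directions: at each vertex $v\ne o$, the three neighbors are indexed $1$ (left child), $2$ (right child), $3$ (parent). At $o$, direction $i$ points to the root of $Y^{(i)}$, $i=1,2,3$. Rotors cycle through $1,2,3,1,\ldots$ in order. The rightmost path in $Y^{(3)}$ is the path starting at the root of $Y^{(3)}$ (the neighbor of $o$ in direction $3$) and moving repeatedly to the right child (direction $2$); it includes the root of $Y^{(3)}$. Rotor-router walk: when a chip is at $v$, the rotor at $v$ first advances to the next direction, and then the chip moves to the neighbor in that direction. Each chip is started at $o$ and walks until it first returns to $o$, where it stops; if it never returns to $o$, it visits each vertex only finitely many times, so the rotor configuration after it has escaped to infinity is well defined. Each chip starts with the rotor configuration left by the previous chip. *)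

(* Defs.v *)
From HB Require Import structures.
From mathcomp Require Import all_boot all_order all_algebra.
From mathcomp Require Import all_classical all_reals all_analysis.

Set Implicit Arguments.
Unset Strict Implicit.
Unset Printing Implicit Defensive.

Import Order.TTheory GRing.Theory Num.Theory.

Local Open Scope classical_set_scope.
Local Open Scope ring_scope.

(* [None] is the origin o.  [Some (i, s)] lies in the principal branch rooted
   at the neighbour of o in direction i; [s] lists the left (false) / right
   (true) turns leading to it from the root of the branch, last turn first. *)
Definition vertex : Type := option ('I_3 * seq bool).

Definition origin : vertex := None.

(* The directions (and branches) 1, 2, 3 are the ordinals 0, 1, 2 of 'I_3. *)
Definition dir1 : 'I_3 := @Ordinal 3 0 isT.
Definition dir2 : 'I_3 := @Ordinal 3 1 isT.
Definition dir3 : 'I_3 := @Ordinal 3 2 isT.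

Definition parent (i : 'I_3) (s : seq bool) : vertex :=
  if s is _ :: s' then Some (i, s') else origin.

Definition neighbor (v : vertex) (d : 'I_3) : vertex :=
  if v is Some (i, s) then
    if d == dir1 then Some (i, false :: s)
    else if d == dir2 then Some (i, true :: s)
    else parent i s
  else Some (d, [::]).

Definition adjacent (u v : vertex) : bool := [exists d, neighbor u d == v].

Definition rotor_config : Type := vertex -> 'I_3.

Definition rightmost_path3 (v : vertex) : bool :=
  if v is Some (i, s) then (i == dir3) && all id s else false.

Definition initial_config : rotor_config :=
  fun v => if rightmost_path3 v then dir2 else dir1.

(* [ordS] is the cyclic successor on 'I_3. *)
Definition rotor_step (st : vertex * rotor_config) : vertex * rotor_config :=
  let: (v, rho) := st in
  let d := ordS (rho v) in
  (neighbor v d, fun u => if u == v then d else rho u).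

(* State of a chip started at o, after its first step and n further steps; the
   chip stops as soon as it is back at o. *)
Definition chip_run (rho : rotor_config) (n : nat) : vertex * rotor_config :=
  iter n (fun st => if st.1 == origin then st else rotor_step st)
       (rotor_step (origin, rho)).

Definition chip_returns (rho : rotor_config) : Prop :=
  exists n, (chip_run rho n).1 = origin.

(* The rotor at v left behind by the chip is the eventual value of the rotor
   at v.  This covers both a chip that returns (its run is then eventually
   constant) and one that escapes (it visits v finitely often).  The default
   value dir1 would only be used if the rotor at v did not stabilize. *)
Definition config_after (rho : rotor_config) : rotor_config :=
  fun v => xget dir1 [set d | \forall n \near \oo, (chip_run rho n).2 v = d].

(* R(m): the (k+1)-st chip starts from the configuration left by the k-th. *)
Definition rotor_returns (m : nat) : nat :=
  (\sum_(k < m) `[< chip_returns (iter k config_after initial_config) >])%N.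

Section RandomWalk.
Context {d : measure_display} {Omega : measurableType d} {R : realType}.
Variable P : probability Omega R.

Definition srw_transition (u v : vertex) : R :=
  if adjacent u v then 3%:R^-1 else 0.

Definition simple_random_walk (X : nat -> Omega -> vertex) : Prop :=
  [/\ forall n v, measurable (X n @^-1` [set v]),
      P (X 0%N @^-1` [set origin]) = 1%E &
      forall n (x : nat -> vertex),
        P [set w | forall k, (k <= n.+1)%N -> X k w = x k] =
        (P [set w | forall k, (k <= n)%N -> X k w = x k] *
         (srw_transition (x n) (x n.+1))%:E)%E].

Definition process_sigma (X : nat -> Omega -> vertex) : set (set Omega) :=
  <<s [set A | exists n v, A = X n @^-1` [set v]] >>.

(* The product rule for subfamilies is the case A i = setT for the other i. *)
Definition independent_processes (m : nat)
    (X : 'I_m -> nat -> Omega -> vertex) : Prop :=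
  forall A : 'I_m -> set Omega, (forall i, process_sigma (X i) (A i)) ->
    P (\bigcap_(i in [set: 'I_m]) A i) = (\prod_(i < m) P (A i))%E.

Definition walk_returns (X : nat -> Omega -> vertex) (w : Omega) : Prop :=
  exists2 n, (0 < n)%N & X n w = origin.

Definition walk_return_count (m : nat) (X : 'I_m -> nat -> Omega -> vertex)
    (w : Omega) : R :=
  (\sum_(i < m) `[< walk_returns (X i) w >])%N%:R.

End RandomWalk.

(* Main.v *)
Require Import Defs.
From mathcomp Require Import all_boot all_order all_algebra.
From mathcomp Require Import all_classical all_reals all_analysis.
From mathcomp Require Import measurable_realfun.
From mathcomp Require Import zify ring lra.

(* A chip entering a binary tree whose rotors all point in direction 1 runs down
   the rightmost path to infinity, and the tree it leaves behind is the initial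
   state of the third branch.  The state of the tree after n chips is described
   recursively: its two subtrees are in the states reached after explicit
   smaller numbers of chips.  By strong induction on n, the next chip escapes
   when n is even and is sent back to the root's parent when n is odd.  Since the
   rotor at o distributes the chips cyclically, and the third branch is one chip
   ahead, the chips started at o alternately escape and return, so
   R(m) = floor (m/2).

   For the random walk, 2^-|v| is harmonic away from o, and (2/3)^|v| shrinks
   in mean by the factor 17/18 at each step, so that the walk returns to o with
   probability exactly 1/2 and E(m) = m/2. *)

Set Implicit Arguments.
Unset Strict Implicit.
Unset Printing Implicit Defensive.

Import Order.TTheory GRing.Theory Num.Theory numFieldNormedType.Exports.

Local Open Scope classical_set_scope.

(** * Rotor walk *)

(** Convertible to the step iterated in [chip_run], so that [chip_runE] holds by computation. *)
Definition stopped_step (st : vertex * rotor_config) : vertex * rotor_config :=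
  if st.1 == origin then st else rotor_step st.

Definition update (rho : rotor_config) (v : vertex) (d : 'I_3) : rotor_config :=
  fun u => if u == v then d else rho u.

Definition reaches (st st' : vertex * rotor_config) : Prop :=
  exists k, iter k stopped_step st = st'.

Definition escapes (st : vertex * rotor_config) (rho : rotor_config) : Prop :=
  (forall k, (iter k stopped_step st).1 <> origin) /\
  (forall v, exists N, forall k, (N <= k)%N ->
     (iter k stopped_step st).2 v = rho v).

Lemma reaches_trans st1 st2 st3 :
  reaches st1 st2 -> reaches st2 st3 -> reaches st1 st3.
Proof. by move=> [j <-] [k <-]; exists (k + j)%N; rewrite iterD. Qed.

Lemma reaches_step i s rho (d := ordS (rho (Some (i, s)))) :
  reaches (Some (i, s), rho)
          (neighbor (Some (i, s)) d, update rho (Some (i, s)) d).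
Proof. by exists 1%N. Qed.

Lemma iter_stopped_origin k rho :
  iter k stopped_step (origin, rho) = (origin, rho).
Proof. by elim: k => //= k ->. Qed.

Lemma escapes_reaches st st' rho :
  reaches st st' -> escapes st' rho -> escapes st rho.
Proof.
move=> [j jE] [H1 H2]; split=> [k kE|v].
  apply: (H1 k); rewrite -jE -iterD addnC iterD.
  by case: (iter k _ st) kE => u r /= ->; rewrite iter_stopped_origin.
have [N HN] := H2 v; exists (N + j)%N => k le_k.
have le_jk : (j <= k)%N by rewrite (leq_trans _ le_k) ?leq_addl.
by rewrite -(subnK le_jk) iterD jE HN // -(leq_add2r j) subnK.
Qed.

(** * Subtrees *)

(** [catrev] reverses [t], so turns are read here outward from [(i, s)], as in [branch_config]. *)
Definition descendant (i : 'I_3) (s : seq bool) (v : vertex) : Prop :=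
  exists t, v = Some (i, catrev t s).

Lemma descendant_child i b s v : descendant i (b :: s) v -> descendant i s v.
Proof. by move=> [t ->]; exists (b :: t). Qed.

Lemma descendant_self i s : descendant i s (Some (i, s)).
Proof. by exists [::]. Qed.

Lemma not_descendant_parent i b s : ~ descendant i (b :: s) (Some (i, s)).
Proof.
by move=> [t [/(congr1 size)]]; rewrite catrevE size_cat size_rev /=; lia.
Qed.

Lemma not_descendant_sibling i b b' s t : b != b' ->
  ~ descendant i (b' :: s) (Some (i, catrev t (b :: s))).
Proof.
move=> neq_b [t' [E]]; move: (E); rewrite !catrevE => /eqP.
have st : size t = size t'.
  by move/(congr1 size): E; rewrite !catrevE !size_cat !size_rev /=; lia.
rewrite eqseq_cat ?size_rev // => /andP[_ /eqP[bE]].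
by rewrite bE eqxx in neq_b.
Qed.

(** * State of a branch after n chips *)

(* The configuration of a binary tree whose rotors all pointed in direction 1,
   after [n] chips have entered it through its root: [branch_rotor n] is the
   rotor at its root, and [branch_child n b] is the number of chips that have
   entered the left ([b = false]) or right ([b = true]) subtree of the root. *)
Definition branch_rotor (n : nat) : 'I_3 :=
  if n is 0 then dir1 else
  match (n %% 4)%N with 1 => dir2 | 3 => dir1 | _ => dir3 end.

Definition branch_child (n : nat) (b : bool) : nat :=
  if b then (n %/ 4 + (n + 3) %/ 4)%N else (n.-1)./2.

(* [t] lists the turns in the opposite order to [vertex]: first turn first. *)
Fixpoint branch_config (n : nat) (t : seq bool) : 'I_3 :=
  if t is b :: t' then branch_config (branch_child n b) t' else branch_rotor n.

Definition agrees (rho : rotor_config) (i : 'I_3) (s : seq bool) (n : nat) :=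
  forall t, rho (Some (i, catrev t s)) = branch_config n t.

Lemma agrees_children rho i s n :
  rho (Some (i, s)) = branch_rotor n ->
  (forall b, agrees rho i (b :: s) (branch_child n b)) -> agrees rho i s n.
Proof. by move=> H1 H2 [|b t] //=; apply: H2. Qed.

Lemma agrees_child rho i s n b :
  agrees rho i s n -> agrees rho i (b :: s) (branch_child n b).
Proof. by move=> H t; apply: (H (b :: t)). Qed.

Lemma agrees_update rho i b s d n : agrees rho i (b :: s) n ->
  agrees (update rho (Some (i, s)) d) i (b :: s) n.
Proof.
move=> H t; rewrite /update; case: eqP => [E|_]; last exact: H.
by case: (@not_descendant_parent i b s); exists t.
Qed.

Lemma update_self rho v d : update rho v d v = d.
Proof. by rewrite /update eqxx. Qed.

(** Locality: a chip moving in one subtree must not disturb the rotor of the parent or the sibling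
    subtree. *)
Definition same_outside i s (rho rho' : rotor_config) :=
  forall v, ~ descendant i s v -> rho' v = rho v.

Lemma same_outside_trans i s rho1 rho2 rho3 :
  same_outside i s rho1 rho2 -> same_outside i s rho2 rho3 ->
  same_outside i s rho1 rho3.
Proof. by move=> H1 H2 v vP; rewrite H2 // H1. Qed.

Lemma same_outside_child i b s rho rho' :
  same_outside i (b :: s) rho rho' -> same_outside i s rho rho'.
Proof. by move=> H v vP; apply: H => /descendant_child. Qed.

Lemma same_outside_update i s (rho : rotor_config) e :
  same_outside i s rho (update rho (Some (i, s)) e).
Proof.
move=> v vP; rewrite /update; case: eqP => // vE.
by case: vP; rewrite vE; apply: descendant_self.
Qed.

Lemma same_outside_sibling i b b' s n rho rho' :
  b != b' -> same_outside i (b' :: s) rho rho' ->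
  agrees rho i (b :: s) n -> agrees rho' i (b :: s) n.
Proof. by move=> Hb H Ha t; rewrite H ?Ha //; apply: not_descendant_sibling. Qed.

Lemma same_outside_parent i b s rho rho' :
  same_outside i (b :: s) rho rho' -> rho' (Some (i, s)) = rho (Some (i, s)).
Proof. by apply; apply: not_descendant_parent. Qed.

(** * One chip in a branch *)

(** Quantified over all positions, so that induction on the chip count applies to the two
    subtrees. *)
Definition chip_exits n := forall i s rho, agrees rho i s n ->
  exists rho', [/\ reaches (Some (i, s), rho) (parent i s, rho'),
    same_outside i s rho rho' & agrees rho' i s n.+1].

Definition chip_escapes n := forall i s rho, agrees rho i s n ->
  exists rho', [/\ escapes (Some (i, s), rho) rho',
    same_outside i s rho rho' & agrees rho' i s n.+1].

Lemma branch_config0 t : branch_config 0 t = dir1.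
Proof. by elim: t => //= -[]. Qed.

Lemma branch_config1 t : branch_config 1 t = if all id t then dir2 else dir1.
Proof. by elim: t => //= -[|] t IH //=; rewrite branch_config0. Qed.

Lemma chip_escapes0 : chip_escapes 0.
Proof.
move=> i s rho Hrho.
(* The chip always turns right: [spine] is its path, and [rho_ k] the configuration after [k] steps,
   with the first [k] spine rotors turned to direction 2. *)
pose spine j : vertex := Some (i, nseq j true ++ s).
pose rho_ k : rotor_config :=
  fun v => if has (fun j => v == spine j) (iota 0 k) then dir2 else rho v.
have spineE j : spine j = Some (i, catrev (nseq j true) s).
  by rewrite /spine catrevE rev_nseq.
have spine_inj j k : spine j = spine k -> j = k.
  by move=> [] /(congr1 size); rewrite !size_cat !size_nseq => /addIn.
have iterE k : iter k stopped_step (Some (i, s), rho) = (spine k, rho_ k).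
  elim: k => //= k ->; rewrite /stopped_step /=.
  have -> : rho_ k (spine k) = dir1.
    rewrite /rho_; case: hasP => [[j]|_].
      by rewrite mem_iota => /andP[_ jk] /eqP /spine_inj kE; rewrite kE ltnn in jk.
    by rewrite spineE Hrho branch_config0.
  rewrite (_ : ordS dir1 = dir2); last exact/val_inj.
  congr pair; apply: funext => v.
  rewrite /rho_ -(addn1 k) iotaD has_cat /= orbF add0n.
  by case: eqP; rewrite ?orbT ?orbF.
have descE v : (exists j, v = spine j) -> descendant i s v.
  by move=> [j ->]; exists (nseq j true).
pose len (v : vertex) := if v is Some (_, u) then (size u).+1 else 0%N.
(* If [v] is [spine j] then [j < len v], so the rotor at [v] is final after [len v] steps. *)
exists (fun v => rho_ (len v) v); split.
- split=> [k|v]; first by rewrite iterE.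
  exists (len v) => k le_k; rewrite iterE /rho_ /=.
  congr (if _ then _ else _); apply/hasP/hasP => -[j]; rewrite mem_iota add0n /=.
    move=> jk /eqP vE; exists j; last by rewrite vE.
    by rewrite mem_iota vE /= size_cat size_nseq ltnS leq_addr.
  move=> jl vE; exists j => //; rewrite mem_iota add0n /=.
  exact: leq_trans le_k.
- move=> v vP; rewrite /rho_; case: hasP => // -[j _ /eqP vE].
  by case: vP; apply: descE; exists j.
- move=> t; rewrite branch_config1 /rho_ Hrho branch_config0.
  congr (if _ then _ else _).
  apply/hasP/idP => [[j _ /eqP]|tP].
    rewrite spineE => -[]; rewrite !catrevE => E.
    have st : size t = j.
      by move/(congr1 size): E; rewrite !size_cat !size_rev size_nseq => /addIn.
    move/eqP: E; rewrite eqseq_cat ?size_rev ?size_nseq // => /andP[/eqP].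
    by move/(can_inj revK) => -> _; rewrite all_nseq orbT.
  have tE : t = nseq (size t) true.
    by elim: t tP => //= -[] //= t IH /IH {1}->.
  exists (size t); last by rewrite spineE -tE.
  by rewrite mem_iota /= catrevE size_cat size_rev ltnS leq_addr.
Qed.

(** For [n > 0] the root's behavior depends on [n] modulo 4; the parity of [branch_child] tells
    whether a visited subtree sends the chip back, and this count is below [n]. *)
Lemma chip_in_branch n : if odd n then chip_exits n else chip_escapes n.
Proof.
elim/ltn_ind: n => n IH.
case: (posnP n) => [->|n_gt0]; first exact: chip_escapes0.
have exitsE k : (k < n)%N -> odd k -> chip_exits k.
  by move=> kn ko; have := IH k kn; rewrite ko.
have escapesE k : (k < n)%N -> ~~ odd k -> chip_escapes k.
  by move=> kn /negbTE ko; have := IH k kn; rewrite ko.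
have ordS1 : ordS dir1 = dir2 by apply/val_inj.
have ordS2 : ordS dir2 = dir3 by apply/val_inj.
have ordS3 : ordS dir3 = dir1 by apply/val_inj.
have [k nE] : exists k, n = (4 * k + n %% 4)%N by exists (n %/ 4)%N; lia.
have : (n %% 4 < 4)%N by rewrite ltn_mod.
case r4 : (n %% 4)%N nE => [|[|[|[|r]]]] // nE _; last first.
(* Residue 3: the right count is odd, so the chip comes back from the right and exits. *)
- have -> : odd n by lia.
  move=> i s rho Hrho.
  have R0 : rho (Some (i, s)) = dir1.
    by rewrite (Hrho [::]) /= /branch_rotor r4; case: (n) n_gt0.
  pose rho1 := update rho (Some (i, s)) dir2.
  have reach1 : reaches (Some (i, s), rho) (Some (i, true :: s), rho1).
    by have := reaches_step i s rho; rewrite R0 ordS1.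
  have A1 b : agrees rho1 i (b :: s) (branch_child n b).
    exact/agrees_update/agrees_child.
  have [||rho2 [reach2 out2 A2]] := exitsE (branch_child n true) _ _ _ _ _ (A1 true);
    rewrite /= ?/branch_child; [lia|lia|].
  have R2 : rho2 (Some (i, s)) = dir2.
    by rewrite (same_outside_parent out2) /rho1 update_self.
  exists (update rho2 (Some (i, s)) dir3); split.
  + apply: reaches_trans reach1 _; apply: reaches_trans reach2 _.
    by have := reaches_step i s rho2; rewrite R2 ordS2.
  + refine (same_outside_trans _ (same_outside_update _ _)).
    exact (same_outside_trans (same_outside_update _ _) (same_outside_child out2)).
  + apply: agrees_children => [|b].
      by rewrite update_self /branch_rotor (_ : n.+1 %% 4 = 0)%N //; lia.
    apply: agrees_update; case: b.
      rewrite (_ : branch_child n.+1 true = (branch_child n true).+1) //.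
      by rewrite /branch_child; lia.
    rewrite (_ : branch_child n.+1 false = branch_child n false).
      exact: same_outside_sibling out2 (A1 false).
    by rewrite /branch_child; lia.
(* Residue 2: the left count is even, so the chip escapes on the left. *)
- have -> : odd n = false by lia.
  move=> i s rho Hrho.
  have R0 : rho (Some (i, s)) = dir3.
    by rewrite (Hrho [::]) /= /branch_rotor r4; case: (n) n_gt0.
  pose rho1 := update rho (Some (i, s)) dir1.
  have reach1 : reaches (Some (i, s), rho) (Some (i, false :: s), rho1).
    by have := reaches_step i s rho; rewrite R0 ordS3.
  have A1 b : agrees rho1 i (b :: s) (branch_child n b).
    exact/agrees_update/agrees_child.
  have [||rho2 [esc2 out2 A2]] := escapesE (branch_child n false) _ _ _ _ _ (A1 false);
    rewrite /= ?/branch_child; [lia|lia|].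
  exists rho2; split.
  + exact: escapes_reaches reach1 esc2.
  + exact (same_outside_trans (same_outside_update _ _) (same_outside_child out2)).
  + apply: agrees_children => [|[|]].
    * rewrite (same_outside_parent out2) /rho1 update_self /branch_rotor.
      by rewrite (_ : n.+1 %% 4 = 3)%N //; lia.
    * rewrite (_ : branch_child n.+1 true = branch_child n true).
        exact: same_outside_sibling out2 (A1 true).
      by rewrite /branch_child; lia.
    * rewrite (_ : branch_child n.+1 false = (branch_child n false).+1) //.
      by rewrite /branch_child; lia.
(* Residue 1: the rotor turns to the parent and the chip exits at once. *)
- have -> : odd n by lia.
  move=> i s rho Hrho.
  have R0 : rho (Some (i, s)) = dir2.
    by rewrite (Hrho [::]) /= /branch_rotor r4; case: (n) n_gt0.
  exists (update rho (Some (i, s)) dir3); split.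
  + by have := reaches_step i s rho; rewrite R0 ordS2.
  + exact: same_outside_update.
  + apply: agrees_children => [|b].
      by rewrite update_self /branch_rotor (_ : n.+1 %% 4 = 2)%N //; lia.
    rewrite (_ : branch_child n.+1 b = branch_child n b).
      exact/agrees_update/agrees_child.
    by case: b; rewrite /branch_child; lia.
(* Residue 0: the left count is odd and the right count even, so the chip comes back from the left
   and escapes on the right. *)
- have -> : odd n = false by lia.
  move=> i s rho Hrho.
  have R0 : rho (Some (i, s)) = dir3.
    by rewrite (Hrho [::]) /= /branch_rotor r4; case: (n) n_gt0.
  pose rho1 := update rho (Some (i, s)) dir1.
  have reach1 : reaches (Some (i, s), rho) (Some (i, false :: s), rho1).
    by have := reaches_step i s rho; rewrite R0 ordS3.
  have A1 b : agrees rho1 i (b :: s) (branch_child n b).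
    exact/agrees_update/agrees_child.
  have [||rho2 [reach2 out2 A2]] := exitsE (branch_child n false) _ _ _ _ _ (A1 false);
    rewrite /= ?/branch_child; [lia|lia|].
  have R2 : rho2 (Some (i, s)) = dir1.
    by rewrite (same_outside_parent out2) /rho1 update_self.
  pose rho3 := update rho2 (Some (i, s)) dir2.
  have reach3 : reaches (Some (i, s), rho2) (Some (i, true :: s), rho3).
    by have := reaches_step i s rho2; rewrite R2 ordS1.
  have A3 : agrees rho3 i (true :: s) (branch_child n true).
    by apply: agrees_update; apply: same_outside_sibling out2 (A1 true).
  have [||rho4 [esc4 out4 A4]] := escapesE (branch_child n true) _ _ _ _ _ A3;
    rewrite /= ?/branch_child; [lia|lia|].
  exists rho4; split.
  + apply: escapes_reaches reach1 _; apply: escapes_reaches reach2 _.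
    exact: escapes_reaches reach3 esc4.
  + refine (same_outside_trans _ (same_outside_child out4)).
    refine (same_outside_trans _ (same_outside_update _ _)).
    exact (same_outside_trans (same_outside_update _ _) (same_outside_child out2)).
  + apply: agrees_children => [|[|]].
    * rewrite (same_outside_parent out4) /rho3 update_self /branch_rotor.
      by rewrite (_ : n.+1 %% 4 = 1)%N //; lia.
    * rewrite (_ : branch_child n.+1 true = (branch_child n true).+1) //.
      by rewrite /branch_child; lia.
    * rewrite (_ : branch_child n.+1 false = (branch_child n false).+1).
        by apply: same_outside_sibling out4 _ => //; apply: agrees_update.
      by rewrite /branch_child; lia.
Qed.

(** * Chips started at the origin *)

(** Eventual values are unique, so [xget] picks the stable value and never its default. *)
Lemma config_afterE rho rho' :
  (forall v, exists N, forall k, (N <= k)%N -> (chip_run rho k).2 v = rho' v) ->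
  forall v, config_after rho v = rho' v.
Proof.
move=> H v; rewrite /config_after; have [N HN] := H v.
case: xgetP => [e _ He|]; last first.
  by move=> /(_ (rho' v)); case; exists N => //= k; apply: HN.
case: He => M _ HM; set K := maxn N M.
have <- : (chip_run rho K).2 v = e by exact: HM (leq_maxr N M).
by apply: HN; exact: leq_maxl.
Qed.

Lemma chip_runE rho n (d := ordS (rho origin)) :
  chip_run rho n = iter n stopped_step (Some (d, [::]), update rho origin d).
Proof. by []. Qed.

(* The origin sends chips to directions 2, 3, 1, 2, ..., so [(t + 2 * i) %/ 3]
   of the first [t] chips enter branch [i], plus one fictitious chip for
   direction 3 that accounts for its initial rotors. *)
Definition after_chips (t : nat) (rho : rotor_config) : Prop :=
  rho origin = (t %% 3)%N :> nat /\
  forall i : 'I_3, agrees rho i [::] ((t + 2 * i) %/ 3)%N.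

Lemma after_chips0 : after_chips 0 initial_config.
Proof.
split=> // -[[|[|[|//]]] Hi] t; rewrite catrevE cats0 /=.
- by rewrite branch_config0.
- by rewrite branch_config0.
(* The two encodings list turns in opposite orders, which [all id] does not see. *)
- by rewrite branch_config1 -(all_rev id t).
Qed.

(** The branch entered next has count [(t + 2 * d) %/ 3], which has the parity of [t]; hence escapes
    and returns alternate. *)
Lemma after_chipsS t rho : after_chips t rho ->
  (chip_returns rho <-> odd t) /\ after_chips t.+1 (config_after rho).
Proof.
move=> [R0 A0]; pose d := ordS (rho origin).
have dE : d = (t.+1 %% 3)%N :> nat by rewrite /= R0; lia.
pose rho1 := update rho origin d.
have A1 i : agrees rho1 i [::] ((t + 2 * i) %/ 3)%N by move=> u; rewrite /rho1 /update /= A0.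
(* In both outcomes only the count of branch [d] grows; the formula for the other two gives the same
   value at [t] and [t.+1]. *)
have next rho' : same_outside d [::] rho1 rho' ->
    agrees rho' d [::] ((t + 2 * d) %/ 3).+1 ->
    (forall v, exists N, forall k, (N <= k)%N -> (chip_run rho k).2 v = rho' v) ->
    after_chips t.+1 (config_after rho).
  move=> out A /config_afterE E; split=> [|i].
    by rewrite E out ?update_self // => -[].
  move=> u; rewrite E; have [->|neq] := eqVneq i d.
    by rewrite A; congr branch_config; rewrite dE; lia.
  rewrite out; last by move=> [u' [id _]]; rewrite id eqxx in neq.
  rewrite A1; congr branch_config.
  have : (i <> d :> nat) by move/eqP: neq => neq /val_inj.
  by rewrite dE; have := ltn_ord i; lia.
have := chip_in_branch ((t + 2 * d) %/ 3)%N.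
have -> : odd ((t + 2 * d) %/ 3)%N = odd t by rewrite dE; lia.
case: (odd t) => /(_ d [::] rho1 (A1 d)) [rho' [run out A]].
  have [k kE] := run; split.
    by split=> // _; exists k; rewrite chip_runE kE.
  apply: next out A _ => v; exists k => j le_j; rewrite chip_runE.
  by rewrite -(subnK le_j) iterD kE iter_stopped_origin.
have [H1 H2] := run; split; last by apply: next out A _ => v; exact: H2.
by split=> // -[k]; rewrite chip_runE => /H1.
Qed.

Lemma rotor_returnsE m : rotor_returns m = m./2.
Proof.
have inv t : after_chips t (iter t config_after initial_config).
  by elim: t => [|t IH]; [exact: after_chips0|case: (after_chipsS IH)].
rewrite /rotor_returns; elim: m => [|m IH]; first by rewrite big_ord0.
rewrite big_ord_recr /= {}IH.
have [H _] := after_chipsS (inv m).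
rewrite (_ : `[< _ >] = odd m); first by rewrite uphalf_half addnC.
by apply/asboolP/idP => /H.
Qed.

Local Open Scope ring_scope.

(** * Simple random walk *)

Definition depth (v : vertex) : nat := if v is Some (_, s) then (size s).+1 else 0%N.

(** Makes the three one-step extensions of a cylinder disjoint. *)
Lemma neighbor_inj v : injective (neighbor v).
Proof.
case: v => [[i s]|] [[|[|[|//]]] Hd] [[|[|[|//]]] He] //= H; apply/val_inj => //=;
  by move: H; rewrite /parent; case: s => [|b s] // [] /(congr1 size) /=; lia.
Qed.

Section WalkReturnProbability.
Context {d : measure_display} {Omega : measurableType d} {R : realType}.
Variables (P : probability Omega R) (X : nat -> Omega -> vertex).
Hypothesis X_srw : simple_random_walk P X.

Let pr (A : set Omega) : R := fine (P A).

Let prE A : measurable A -> P A = (pr A)%:E.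
Proof. by move=> mA; rewrite fineK // fin_num_measure. Qed.

Let pr_le A B : measurable A -> measurable B -> A `<=` B -> pr A <= pr B.
Proof.
by move=> mA mB AB; rewrite -lee_fin -!prE // le_measure // inE.
Qed.

Let pr_ge0 A : 0 <= pr A. Proof. by rewrite fine_ge0. Qed.

(** * Cylinders and one-step decomposition *)

Definition cylinder (N : nat) (x : nat -> vertex) : set Omega :=
  [set w | forall k, (k <= N)%N -> X k w = x k].

Lemma measurable_cylinder N x : measurable (cylinder N x).
Proof.
have [mX _ _] := X_srw.
rewrite (_ : cylinder N x = \bigcap_(k in [set k | (k <= N)%N]) (X k @^-1` [set x k])).
  by apply: bigcap_measurable => [|k _]; [exists 0%N|exact: mX].
by apply/seteqP; split => w H k; exact: H.
Qed.

Definition extend (N : nat) (x : nat -> vertex) (e : 'I_3) (k : nat) : vertex :=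
  if (k <= N)%N then x k else neighbor (x N) e.

Lemma extend_last N x e : extend N x e N.+1 = neighbor (x N) e.
Proof. by rewrite /extend ltnn. Qed.

Lemma cylinder_extend N x e : cylinder N.+1 (extend N x e) `<=` cylinder N x.
Proof. by move=> w H k kN; rewrite H ?(leqW kN) // /extend kN. Qed.

Lemma pr_cylinder_extend N x e :
  pr (cylinder N.+1 (extend N x e)) = pr (cylinder N x) / 3%:R.
Proof.
have [_ _ H] := X_srw; apply: EFin_inj.
rewrite -prE; last exact: measurable_cylinder.
rewrite /cylinder H EFinM -prE; last exact: measurable_cylinder.
congr (P _ * _)%E.
  by apply/seteqP; split => w Hw k kN; rewrite Hw // /extend kN.
rewrite extend_last /extend leqnn /srw_transition.
by rewrite (_ : Defs.adjacent _ _ = true) //; apply/existsP; exists e.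
Qed.

(** First-step analysis for lower bounds: the three extended cylinders are disjoint, lie in
    [cylinder N x] and each carry a third of its mass. *)
Lemma pr_cylinder_split N x (E : set Omega) (f : nat -> R) : measurable E ->
  (forall e, pr (cylinder N.+1 (extend N x e)) * f (depth (neighbor (x N) e)) <=
     pr (cylinder N.+1 (extend N x e) `&` E)) ->
  pr (cylinder N x) * ((f (depth (neighbor (x N) dir1)) +
    f (depth (neighbor (x N) dir2)) + f (depth (neighbor (x N) dir3))) / 3%:R)
  <= pr (cylinder N x `&` E).
Proof.
move=> mE H.
pose C e := cylinder N.+1 (extend N x e) `&` E.
have mC e : measurable (C e) by apply: measurableI => //; exact: measurable_cylinder.
have disj e e' : e != e' -> C e `&` C e' = set0.
  move=> ee'; apply/seteqP; split=> // w [[H1 _] [H2 _]].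
  move: (H1 N.+1 (leqnn _)); rewrite (H2 N.+1 (leqnn _)) !extend_last.
  by move/neighbor_inj => eE; rewrite eE eqxx in ee'.
have prU A B : measurable A -> measurable B -> A `&` B = set0 ->
    pr (A `|` B) = pr A + pr B.
  move=> mA mB AB; apply: EFin_inj; rewrite -prE; last exact: measurableU.
  by rewrite measureU // EFinD -!prE.
have UE : pr (C dir1 `|` C dir2 `|` C dir3) = pr (C dir1) + pr (C dir2) + pr (C dir3).
  rewrite prU ?prU ?disj //; first exact: measurableU.
  by rewrite setIUl !disj // setU0.
have : pr (C dir1 `|` C dir2 `|` C dir3) <= pr (cylinder N x `&` E).
  apply: pr_le; first by do !apply: measurableU.
    by apply: measurableI => //; exact: measurable_cylinder.
  by move=> w [[|]|] [Hw Ew]; split => //; exact: cylinder_extend Hw.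
have := H dir1; have := H dir2; have := H dir3; rewrite !pr_cylinder_extend.
rewrite UE /C; lra.
Qed.

Lemma pr_cylinder_sub N x (E : set Omega) : cylinder N x `<=` E ->
  pr (cylinder N x `&` E) = pr (cylinder N x).
Proof. by move=> /setIidPl ->. Qed.

(** * Hitting and avoiding the origin *)

Definition hit_from (N : nat) : set Omega :=
  [set w | exists2 k, (N <= k)%N & X k w = origin].

Definition avoid_between (N n : nat) : set Omega :=
  [set w | forall k, (N <= k <= N + n)%N -> X k w <> origin].

Lemma measurable_hit_from N : measurable (hit_from N).
Proof.
have [mX _ _] := X_srw.
rewrite (_ : hit_from N = \bigcup_(k in [set k | (N <= k)%N]) (X k @^-1` [set origin])).
  by apply: bigcup_measurable => k _; exact: mX.
by apply/seteqP; split => w [k]; exists k.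
Qed.

Lemma measurable_avoid_between N n : measurable (avoid_between N n).
Proof.
have [mX _ _] := X_srw.
rewrite (_ : avoid_between N n =
  \bigcap_(k in [set k | (N <= k <= N + n)%N]) ~` (X k @^-1` [set origin])).
  apply: bigcap_measurable => [|k _]; last exact/measurableC/mX.
  by exists N; rewrite /= leqnn leq_addr.
by apply/seteqP; split => w H k; exact: H.
Qed.

(* [2^-k] is harmonic in the depth [k > 0], while [(2/3)^k] is multiplied by
   [17/18] at each step away from the origin. *)
Lemma pr_hit_from_ge n N x :
  pr (cylinder N x) * (2%:R^-1 ^+ depth (x N)
    - (17%:R / 18%:R) ^+ n * (2%:R / 3%:R) ^+ depth (x N))
  <= pr (cylinder N x `&` hit_from N).
Proof.
have q_ge0 k : 0 <= (17%:R / 18%:R) ^+ k :> R by apply: exprn_ge0; lra.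
have r_ge0 k : 0 <= (2%:R / 3%:R) ^+ k :> R by apply: exprn_ge0; lra.
elim: n N x => [|n IH] N x; have [x0|x_neq0] := eqVneq (x N) origin.
- rewrite pr_cylinder_sub => [|w Hw]; last by exists N => //; rewrite Hw.
  by rewrite ler_piMr // x0 /= !expr0; lra.
(* For [n = 0] the bound is nonpositive, as 1/2 <= 2/3. *)
- apply: (@le_trans _ _ 0) => //; rewrite mulr_ge0_le0 // subr_le0 expr0 mul1r.
  by apply: lerXn2r; rewrite ?nnegrE; lra.
- rewrite pr_cylinder_sub => [|w Hw]; last by exists N => //; rewrite Hw.
  rewrite ler_piMr // x0 /= !expr0 mulr1; have := q_ge0 n.+1; lra.
- pose f k : R := 2%:R^-1 ^+ k - (17%:R / 18%:R) ^+ n * (2%:R / 3%:R) ^+ k.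
  have step e : pr (cylinder N.+1 (extend N x e)) * f (depth (neighbor (x N) e)) <=
      pr (cylinder N.+1 (extend N x e) `&` hit_from N).
    have := IH N.+1 (extend N x e); rewrite extend_last => /le_trans; apply.
    apply: pr_le; try by apply: measurableI;
      [exact: measurable_cylinder|exact: measurable_hit_from].
    by move=> w [? [k Nk ?]]; split=> //; exists k => //; exact: ltnW.
  apply: le_trans (pr_cylinder_split (measurable_hit_from N) step).
  apply: ler_wpM2l => //; rewrite /f.
  case: (x N) x_neq0 => [[i s]|] //= _.
  have -> : depth (parent i s) = size s by case: s.
  (* Averaging over two children and the parent: (1/2 + 1/2 + 2)/3 = 1 and (2/3 + 2/3 + 3/2)/3 =
     17/18. *)
  rewrite !exprS; set a := _ ^+ size s; set b := _ ^+ n; set c := _ ^+ size s.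
  by rewrite le_eqVlt; apply/orP; left; apply/eqP; field.
Qed.

(** The function 1 - 2^-|v| vanishes at o, is at most 1 and is harmonic elsewhere, so the bound is
    uniform in the horizon [n]. *)
Lemma pr_avoid_between_ge n N x :
  pr (cylinder N x) * (1 - 2%:R^-1 ^+ depth (x N))
  <= pr (cylinder N x `&` avoid_between N n).
Proof.
elim: n N x => [|n IH] N x; have [x0|x_neq0] := eqVneq (x N) origin;
  try by rewrite x0 /= expr0 subrr mulr0.
- rewrite pr_cylinder_sub => [|w Hw k]; last first.
    by rewrite addn0 -eqn_leq => /eqP <-; rewrite Hw //; exact/eqP.
  by rewrite ler_piMr // gerBl exprn_ge0 //; lra.
- pose f k : R := 1 - 2%:R^-1 ^+ k.
  have step e : pr (cylinder N.+1 (extend N x e)) * f (depth (neighbor (x N) e)) <=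
      pr (cylinder N.+1 (extend N x e) `&` avoid_between N n.+1).
    have := IH N.+1 (extend N x e); rewrite extend_last => /le_trans; apply.
    apply: pr_le; try by apply: measurableI;
      [exact: measurable_cylinder|exact: measurable_avoid_between].
    move=> w [Hc Ha]; split=> // k /andP[]; rewrite leq_eqVlt => /orP[/eqP <- _|Nk kN].
      by rewrite (cylinder_extend Hc) //; exact/eqP.
    by apply: Ha; rewrite Nk addSnnS.
  apply: le_trans (pr_cylinder_split (measurable_avoid_between N n.+1) step).
  apply: ler_wpM2l => //; rewrite /f.
  case: (x N) x_neq0 => [[i s]|] //= _.
  have -> : depth (parent i s) = size s by case: s.
  rewrite !exprS; lra.
Qed.

(** * The return probability *)

Let pr_start : pr (cylinder 0 (fun=> origin)) = 1.
Proof.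
have [_ X0 _] := X_srw; apply: EFin_inj; rewrite -prE; last exact: measurable_cylinder.
rewrite -X0; congr (P _); apply/seteqP; split => w.
  by move=> /(_ 0%N (leqnn _)).
by move=> H k; rewrite leqn0 => /eqP ->.
Qed.

(** All neighbors of o have depth 1, so a bound common to them is its own average. *)
Let pr_first_step (E : set Omega) (c : R) : measurable E ->
  (forall x, depth (x 1%N) = 1%N -> pr (cylinder 1 x) * c <= pr (cylinder 1 x `&` E)) ->
  c <= pr E.
Proof.
move=> mE H.
have := @pr_cylinder_split 0 (fun=> origin) E (fun=> c) mE.
rewrite pr_start mul1r => /(_ _)/le_trans; rewrite (_ : (c + c + c) / 3%:R = c); last lra.
apply; first by move=> e; apply: H; rewrite extend_last.
apply: pr_le => //; apply: measurableI => //; exact: measurable_cylinder.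
Qed.

Lemma measurable_walk_returns : measurable [set w | walk_returns X w].
Proof. exact: measurable_hit_from. Qed.

Lemma walk_returns_probability : P [set w | walk_returns X w] = (2%:R^-1)%:E.
Proof.
have mh := measurable_hit_from 1.
rewrite prE //; congr EFin; apply/eqP; rewrite eq_le; apply/andP; split.
  (* Upper bound: never returning is the decreasing limit of avoiding o at times 1 to [n + 1], each
     of probability at least 1/2. *)
  have ge_half n : 2%:R^-1 <= pr (avoid_between 1 n).
    apply: pr_first_step; first exact: measurable_avoid_between.
    move=> x x1; apply: le_trans (pr_avoid_between_ge n 1 x).
    by rewrite x1 expr1 ler_wpM2l //; lra.
  have capE : \bigcap_n avoid_between 1 n = ~` hit_from 1.
    apply/seteqP; split => w.
      by move=> H [k k1 kE]; apply: (H k I k) => //; rewrite k1 leqW.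
    by move=> H n _ k /andP[k1 _] kE; apply: H; exists k.
  have : (P \o avoid_between 1) @ \oo --> P (~` hit_from 1).
    rewrite -capE; apply: nonincreasing_cvg_mu.
    + apply: le_lt_trans (ltry 1); apply: probability_le1.
      exact: measurable_avoid_between.
    + by move=> n; exact: measurable_avoid_between.
    + by rewrite capE; exact: measurableC.
    + move=> n m nm; apply/subsetPset => w H k /andP[k1 kn]; apply: H.
      by rewrite k1 (leq_trans kn) // leq_add2l.
  move=> cvgP.
  have : ((2%:R^-1)%:E <= P (~` hit_from 1))%E.
    rewrite -(cvg_lim _ cvgP) //; apply: lime_ge; first by apply/cvg_ex; eexists; exact: cvgP.
    apply: nearW => n /=; rewrite prE ?lee_fin //; exact: measurable_avoid_between.
  rewrite probability_setC // prE // -EFinB lee_fin /pr; lra.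
(* Lower bound: the error term decays geometrically in the horizon [n]. *)
have ge_n n : 2%:R^-1 - (17%:R / 18%:R) ^+ n * (2%:R / 3%:R) <= pr (hit_from 1).
  apply: pr_first_step => // x x1; have := pr_hit_from_ge n 1 x.
  by rewrite x1 !expr1.
have cvg0 : 2%:R^-1 - (17%:R / 18%:R) ^+ n * (2%:R / 3%:R) @[n --> \oo] --> (2%:R^-1 : R).
  rewrite -[X in _ --> X]subr0; apply: cvgB; first exact: cvg_cst.
  rewrite -[X in _ --> X](mul0r (2%:R / 3%:R)); apply: cvgM; last exact: cvg_cst.
  by apply: cvg_expr; rewrite ger0_norm; lra.
rewrite -(cvg_lim _ cvg0) //; apply: limr_le; first by apply/cvg_ex; eexists; exact: cvg0.
exact: nearW.
Qed.

End WalkReturnProbability.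

(** * Expected number of returns and comparison *)

(** Linearity of expectation over the indicators of return. *)
Lemma expected_walk_returns (R : realType) (d : measure_display)
    (Omega : measurableType d) (P : probability Omega R)
    (m : nat) (X : 'I_m -> nat -> Omega -> vertex) :
  (forall i, simple_random_walk P (X i)) ->
  ('E_P[walk_return_count X] = (m%:R / 2%:R)%:E)%E.
Proof.
move=> X_srw.
pose A i := [set w | walk_returns (X i) w].
have mA i : measurable (A i) by exact: measurable_walk_returns (X_srw i).
rewrite unlock.
transitivity (\int[P]_w (\sum_(i < m) (\1_(A i) w : R)%:E))%E.
  apply: eq_integral => w _; rewrite sumEFin /walk_return_count natr_sum.
  congr EFin; apply: eq_bigr => i _; rewrite indicE.
rewrite ge0_integral_sum //; last first.
  by move=> i; apply/measurable_EFinP; exact: measurable_indic.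
transitivity (\sum_(i < m) (2%:R^-1 : R)%:E)%E.
  apply: eq_bigr => i _; rewrite integral_indic // setIT.
  exact: walk_returns_probability (X_srw i).
by rewrite sumEFin sumr_const card_ord mulr_natl.
Qed.

Local Open Scope ereal_scope.

Theorem proposition4p2 (R : realType) (d : measure_display)
    (Omega : measurableType d) (P : probability Omega R)
    (m : nat) (X : 'I_m -> nat -> Omega -> vertex)
    (X_srw : forall i, simple_random_walk P (X i))
    (X_indep : independent_processes P X) :
  `| 'E_P[walk_return_count X] - ((rotor_returns m)%:R)%:E | <= (2%:R^-1)%:E.
Proof.
rewrite expected_walk_returns // rotor_returnsE -EFinB abse_EFin lee_fin.
(* By this decomposition the difference is exactly 1/2 for odd [m] and 0 for even [m]. *)
have mE : (m%:R = (odd m)%:R + (m./2)%:R * 2%:R :> R)%R.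
  by rewrite -natrM muln2 -natrD odd_double_half.
rewrite mE mulrDl mulfK ?pnatr_eq0 // addrK ger0_norm.
  by case: (odd m); rewrite ?mul1r ?mul0r ?invr_ge0.
by rewrite divr_ge0.
Qed.
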